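(* Let $\Sigma$ be a finite alphabet with at least two letters, and let $n\ge 2$ and $1\le k\le n-1$ be integers with $k\ge n/2$. Let $(L_1,R_1)$ be a partition of $\Sigma$ into two non-empty parts, and for every $i\in\{2,\dots,k\}$ let $(L_i,R_i)$ be a partition of $\bigcup_{j=1}^{i-1}L_jR_{i-j}$ into two disjoint, possibly empty, parts. Then $$C=\bigcup_{s=k+1}^{n}\ \bigcup_{j=s-k}^{k}\ \bigcup_{\alpha}\ \bigcup_{i=0}^{\mathrm{par}(\alpha)} L_{\alpha_1}\cdots L_{\alpha_i}\,L_jR_{s-j}\,R_{\alpha_{i+1}}\cdots R_{\alpha_{\mathrm{par}(\alpha)}}\subseteq\Sigma^n,$$ where $\alpha$ ranges over all compositions of $n-s$, is a $(1,k)$-overlap-free code.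
   Context: For sets of words $L,R$, $LR$ denotes the set of all concatenations $lr$ with $l\in L$, $r\in R$. A composition of a positive integer $m$ is a tuple $\alpha=(\alpha_1,\dots,\alpha_p)$ of positive integers with sum $m$; $\mathrm{par}(\alpha)=p$ is its number of parts; the only composition of $0$ is the empty one, with $\mathrm{par}=0$. Two (not necessarily distinct) words $u,v$ have a $t$-overlap if the prefix of $u$ of length $t$ equals the suffix of $v$ of length $t$, or vice versa. A code $C\subseteq\Sigma^n$ is $(1,k)$-overlap-free if for all $1\le t\le k$ no two (not necessarily distinct) codewords have a $t$-overlap. *)

(* Defs.v *)
From mathcomp Require Import all_boot.
From mathcomp Require Import boolp classical_sets.

Set Implicit Arguments.
Unset Strict Implicit.
Unset Printing Implicit Defensive.

Local Open Scope classical_set_scope.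

Definition language (T : Type) := set (seq T).

Definition lcat (T : Type) (A B : language T) : language T :=
  [set l ++ r | l in A & r in B].

Notation "A *^ B" := (lcat A B)
  (at level 40, left associativity) : classical_set_scope.

Definition lprod (T : Type) (F : nat -> language T) (s : seq nat) :
  language T := foldr (fun a P => F a *^ P) [set [::]] s.

Definition words (T : Type) (n : nat) : language T := [set w | size w = n].

Definition partition2 (T : Type) (X A B : set T) : Prop :=
  A `|` B = X /\ A `&` B = set0.

Definition compositions (m : nat) : set (seq nat) :=
  [set alpha | all (fun a => 0 < a) alpha /\ sumn alpha = m].

Definition has_overlap (T : eqType) (t : nat) (u v : seq T) : Prop :=
  (exists w, [/\ size w = t, prefix w u & suffix w v]) \/
  (exists w, [/\ size w = t, prefix w v & suffix w u]).

Definition overlap_free_code (T : eqType) (n k : nat) (C : language T) : Prop :=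
  C `<=` @words T n /\
  forall t, 1 <= t <= k ->
  forall u v, C u -> C v -> ~ has_overlap t u v.

(* The values [L 0], [R 0] and those at indices above [k] are junk: all the
   conditions here, and [overlap_code] below when [n <= 2 * k], only use
   indices between 1 and [k]. *)
Definition LR_family (T : Type) (k : nat) (L R : nat -> language T) : Prop :=
  [/\ partition2 (@words T 1) (L 1) (R 1),
      L 1 !=set0,
      R 1 !=set0
    & forall i, 2 <= i <= k ->
      partition2 (\bigcup_(j in [set j | 1 <= j <= i.-1]) (L j *^ R (i - j)))
                 (L i) (R i)].

Definition overlap_code (T : Type) (n k : nat) (L R : nat -> language T) :
    language T :=
  \bigcup_(s in [set s | k.+1 <= s <= n])
  \bigcup_(j in [set j | s - k <= j <= k])
  \bigcup_(alpha in compositions (n - s))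
  \bigcup_(i in [set i | 0 <= i <= size alpha])
    (lprod L (take i alpha) *^ (L j *^ R (s - j)) *^ lprod R (drop i alpha)).

(* Main.v *)
Require Import Defs.
From mathcomp Require Import all_boot.
From mathcomp Require Import boolp classical_sets.

(** Let [A] and [B] be the unions of the [L i] and of the [R i], [1 <= i <= k].
    A word of [A] or [B] is a letter or lies in [A *^ B], so by induction on the
    length its proper prefixes lie in [star A] and its proper suffixes in
    [star B].  A codeword lies in [star A *^ (A *^ B) *^ star B] with middle
    factor longer than [k], so its prefixes of length at most [k] lie in
    [star A] and its suffixes of length at most [k] in [star B].  Finally,
    [star A] and [star B] only share the empty word: in a shortest nonempty
    common word with at least two [B]-factors, the first [B]-factor is a prefix
    of a word of [star A], hence a shorter common word; the same holds at the
    other end, so the word lies in both [A] and [B], which are disjoint. *)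

Set Implicit Arguments.
Unset Strict Implicit.
Unset Printing Implicit Defensive.

Local Open Scope classical_set_scope.

(** * Levi's lemma, Kleene stars and reversal of languages *)

Lemma eq_cat_cat (T : Type) (a b p q : seq T) : a ++ b = p ++ q ->
  (exists2 c, a = p ++ c & q = c ++ b) \/ (exists2 c, p = a ++ c & b = c ++ q).
Proof.
elim: a p => [|x a IH] [|y p] /=.
- by move=> ->; left; exists [::].
- by move=> ->; right; exists (y :: p).
- by move=> <-; left; exists (x :: a).
- by case=> <- /IH[] [c -> ->]; [left | right]; exists c.
Qed.

Inductive star (T : Type) (A : language T) : language T :=
| star_nil : star A [::]
| star_cons u w of A u & star A w : star A (u ++ w).

Lemma star1 (T : Type) (A : language T) w : A w -> star A w.
Proof. by move=> Aw; rewrite -[w]cats0; apply: star_cons => //; apply: star_nil. Qed.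

Lemma star_cat (T : Type) (A : language T) v w :
  star A v -> star A w -> star A (v ++ w).
Proof. by move=> Av Aw; elim: Av => //= a b Aa _ IH; rewrite -catA; apply: star_cons. Qed.

(** A cut falls at the end of a factor or strictly inside it: the whole factors before it are in
    [A], so the hypothesis is only needed for the factor that is cut. *)
Lemma star_prefix_closed (T : Type) (A : language T) :
    (forall p q, A (p ++ q) -> 0 < size q -> star A p) ->
  forall p q, star A (p ++ q) -> star A p.
Proof.
move=> pA p q; move: {-2}(p ++ q) (erefl (p ++ q)) => w + Aw.
elim: Aw p => [|a b Aa _ IH] p; first by case: p => // _; apply: star_nil.
move/eq_cat_cat => [] [c].
  case: c => [|x c] Ea _; first by rewrite cats0 in Ea; subst; apply: star1.
  by apply: (pA p (x :: c)) => //; rewrite -Ea.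
by move=> -> /IH; apply: star_cons.
Qed.

Definition revl (T : Type) (A : language T) : language T := [set w | A (rev w)].

Lemma revlK (T : Type) (A : language T) : revl (revl A) = A.
Proof. by rewrite /revl; apply/funext => w /=; rewrite revK. Qed.

Lemma star_rev (T : Type) (A : language T) w : star A w -> star (revl A) (rev w).
Proof.
elim=> [|a b Aa _ IH]; first exact: star_nil.
by rewrite rev_cat; apply: star_cat IH _; apply: star1; rewrite /revl /= revK.
Qed.

(** * Splitting pairs: an index-free abstraction of the unions of the [L i] and of the [R i] *)

Definition splitting_pair (T : Type) (A B : language T) : Prop :=
  [/\ forall w, (A `|` B) w -> 0 < size w,
      forall w, (A `|` B) w -> size w = 1 \/ (A *^ B) w
    & A `&` B = set0].

(** Reversal turns a product [l ++ r] into [rev r ++ rev l], so the two languages exchange roles.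
    Every suffix statement about [B] thereby follows from a prefix statement about [A]. *)
Lemma splitting_pair_rev (T : Type) (A B : language T) :
  splitting_pair A B -> splitting_pair (revl B) (revl A).
Proof.
move=> [pos split AB0]; split => [w|w|].
- by rewrite -(size_rev w) => BAw; apply: pos; rewrite setUC.
- rewrite -(size_rev w) => BAw.
  have /split[->|] : (A `|` B) (rev w) by rewrite setUC.
    by left.
  move=> [l Al [r Br lr]]; right; exists (rev r); first by rewrite /revl /= revK.
  by exists (rev l); rewrite ?/revl /= ?revK // -rev_cat lr revK.
- by apply/seteqP; split => // w [Bw Aw]; have : (A `&` B) (rev w) by []; rewrite AB0.
Qed.

(** Split the word as [l ++ r]. A cut in [l] is handled by induction; a cut in [r] gives
    [p = l ++ c] with [c] a proper prefix of [r]. Since [r] is in [B], the induction has to treat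
    words of [A] and of [B] together. *)
Lemma splitting_pair_prefix (T : Type) (A B : language T) :
    splitting_pair A B ->
  forall p q, (A `|` B) (p ++ q) -> 0 < size q -> star A p.
Proof.
move=> [pos split _] p q; have [m] := ubnP (size (p ++ q)).
elim: m p q => // m IH p q lt_m ABpq q0.
case: (split _ ABpq) => [|[l Al [r Br]]].
  rewrite size_cat; case: p {lt_m ABpq} => [|x p] /=; first by move=> _; apply: star_nil.
  by case: q q0 => //= y q _; rewrite addSn addnS.
move=> E; have l0 := pos l (or_introl Al); have r0 := pos r (or_intror Br).
move: lt_m; rewrite -E => lt_m.
case: (eq_cat_cat E) => [] [c].
  case: c => [|x c] El _; first by rewrite cats0 in El; subst; apply: star1.
  apply: (IH p (x :: c)) => //; last by rewrite -El; left.
  rewrite -El; move: lt_m; rewrite size_cat ltnS; apply: leq_trans.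
  by rewrite -addn1 leq_add2l.
move=> -> Er; apply: star_cons => //; apply: (IH c q) => //; rewrite -Er; last by right.
move: lt_m; rewrite size_cat ltnS; apply: leq_trans.
by rewrite -add1n leq_add2r.
Qed.

Lemma star_prefix (T : Type) (A B : language T) (AB : splitting_pair A B) p q :
  star A (p ++ q) -> star A p.
Proof.
apply: star_prefix_closed => a b Aab; apply: splitting_pair_prefix AB _ _ _.
by left.
Qed.

Lemma star_suffix (T : Type) (A B : language T) (AB : splitting_pair A B) p q :
  star B (p ++ q) -> star B q.
Proof.
move=> /star_rev; rewrite rev_cat => /(star_prefix (splitting_pair_rev AB)).
by move=> /star_rev; rewrite revlK revK.
Qed.

Lemma star_disjoint (T : Type) (A B : language T) (AB : splitting_pair A B) w :
  star A w -> star B w -> w = [::].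
Proof.
case: (AB) => pos _ AB0.
have [m] := ubnP (size w); elim: m w => // m IH w lt_m Aw Bw.
case: Bw Aw lt_m => // r r' Br Br' Aw lt_m.
have r0 := pos r (or_intror Br).
case: r' => [|x r'] in Br' Aw lt_m *; last first.
  have Ar := star_prefix AB Aw.
  suff : r = [::] by move=> r_nil; rewrite r_nil in r0.
  apply: IH (star1 Br) => //; move: lt_m; rewrite size_cat ltnS; apply: leq_trans.
  by rewrite /= addnS ltnS leq_addr.
(* With a single [B]-factor the word is [r] itself; it remains to count its [A]-factors. *)
rewrite cats0 in Aw lt_m *.
case: Aw Br r0 lt_m => // l l' Al Al' Br _ lt_m; have l0 := pos l (or_introl Al).
case: l' => [|x l'] in Al' Br lt_m *.
  by rewrite cats0 in Br; have : (A `&` B) l by []; rewrite AB0.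
have Bl' := star_suffix AB (star1 Br).
suff : x :: l' = [::] by [].
apply: IH => //; move: lt_m; rewrite size_cat ltnS; apply: leq_trans.
by rewrite -add1n leq_add2r.
Qed.

(** The prefix [p] may end in [x], in [l] or in [r]. The length bound keeps it from containing all
    of [l ++ r], which matters because [r] itself is in [B]: only its proper prefixes are known to
    be in [star A]. *)
Lemma star_code_prefix (T : Type) (A B : language T) x l r y p q :
    splitting_pair A B -> star A x -> A l -> B r ->
    x ++ (l ++ r) ++ y = p ++ q -> size p < size (l ++ r) ->
  star A p.
Proof.
move=> AB Ax Al Br /eq_cat_cat[[c Ex _] _|[c -> E]].
  by rewrite Ex in Ax; apply: star_prefix AB _ _ Ax.
rewrite size_cat => lt_c; apply: star_cat Ax _.
move: E; rewrite -catA => /eq_cat_cat[[d El _]|[d Ec]].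
  by apply: (star_prefix AB (q := d)); rewrite -El; apply: star1.
rewrite Ec; rewrite {}Ec in lt_c => /eq_cat_cat[[e Er _]|[e Ed _]].
  apply: star_cons => //; apply: (splitting_pair_prefix AB (q := e)).
    by rewrite -Er; right.
  (* An empty [e] would mean that [p] contains the whole of [l ++ r]. *)
  case: e Er => // Er; move: lt_c.
  by rewrite Er cats0 !size_cat ltnNge leq_addl.
by move: lt_c; rewrite Ed !size_cat ltnNge (addnA (size l)) addnCA leq_addr.
Qed.

Lemma star_code_suffix (T : Type) (A B : language T) x l r y p q :
    splitting_pair A B -> star B y -> A l -> B r ->
    x ++ (l ++ r) ++ y = p ++ q -> size q < size (l ++ r) ->
  star B q.
Proof.
move=> AB By Al Br E lt_q; rewrite -(revlK B) -(revK q); apply: star_rev.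
apply: (@star_code_prefix _ _ (revl A) (rev y) (rev r) (rev l) (rev x) _ (rev p)).
- exact: splitting_pair_rev.
- exact: star_rev.
- by rewrite /revl /= revK.
- by rewrite /revl /= revK.
- by rewrite -!rev_cat -E !catA.
- by rewrite -rev_cat !size_rev.
Qed.

(** * The splitting pair of an [LR_family] *)

Definition level_union (T : Type) (k : nat) (F : nat -> language T) : language T :=
  \bigcup_(i in [set i | 1 <= i <= k]) F i.

Lemma LR_family_size (T : Type) k (L R : nat -> language T) :
    LR_family k L R ->
  forall i, 1 <= i <= k -> L i `|` R i `<=` @words T i.
Proof.
case=> [[LR1 _] _ _ LRi] i; elim/ltn_ind: i => i IH /andP[i0 ik].
have [i1|i1] := leqP i 1.
  by have -> : i = 1; [apply/eqP; rewrite eqn_leq i1 | rewrite LR1].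
have [|-> _] := LRi i; first by rewrite i1.
move=> _ [j /andP[j0 ji] [l Ll [r Rr <-]]].
have lt_ji : j < i by rewrite -(prednK i0) ltnS.
rewrite /words /= size_cat.
have -> : size l = j.
  by apply: IH => //; [rewrite j0 (leq_trans (ltnW lt_ji))|left].
have -> : size r = i - j; last by rewrite subnKC // ltnW.
apply: IH; last by right.
  by rewrite -subn_gt0 subKn // ltnW.
by rewrite subn_gt0 lt_ji (leq_trans (leq_subr _ _)).
Qed.

Lemma LR_family_splitting (T : Type) k (L R : nat -> language T) :
  LR_family k L R -> splitting_pair (level_union k L) (level_union k R).
Proof.
move=> LR; have sizeLR := LR_family_size LR; case: LR => [[LR1 LR10] _ _ LRi].
have levelE w : (level_union k L `|` level_union k R) w ->
    exists2 i, 1 <= i <= k & (L i `|` R i) w.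
  by case=> [] [i ik iw]; exists i => //; [left | right].
split => [w /levelE[i ik LRw]|w /levelE[i ik LRw]|].
- by have -> := sizeLR i ik w LRw; case/andP: ik.
- case/andP: (ik) => i0 i_k; have [i1|i1] := leqP i 1.
    by left; have -> := sizeLR i ik w LRw; apply/eqP; rewrite eqn_leq i1.
  right; have [|LRiE _] := LRi i; first by rewrite i1.
  move: LRw; rewrite LRiE => -[j /andP[j0 ji] [l Ll [r Rr <-]]].
  have lt_ji : j < i by rewrite -(prednK i0) ltnS.
  exists l; first by exists j; rewrite //= j0 (leq_trans (ltnW lt_ji)).
  exists r => //; exists (i - j) => //=.
  by rewrite subn_gt0 lt_ji (leq_trans (leq_subr _ _)).
- apply/seteqP; split => // w [[i ik Lw] [j jk Rw]].
  (* The length of a word determines its level, so a common word of the two unions lies in [L i] and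
     [R i] for the same [i]. *)
  have Ei : size w = i by apply: sizeLR => //; left.
  have Ej : size w = j by apply: sizeLR => //; right.
  rewrite -{}Ej {j jk} Ei in Rw; case/andP: (ik) => i0 i_k.
  have [i1|i1] := leqP i 1.
    have Ei1 : i = 1 by apply/eqP; rewrite eqn_leq i1.
    by rewrite -LR10 -Ei1.
  by have [|_ <-] := LRi i; first by rewrite i1.
Qed.

(** * Factorization of codewords *)

Lemma lprod_size (T : Type) (F : nat -> language T) s w :
  (forall i, i \in s -> F i `<=` @words T i) -> lprod F s w -> size w = sumn s.
Proof.
elim: s w => [|a s IH] w Fs /=; first by move=> ->.
move=> [u Fu [v Fv <-]]; rewrite size_cat (IH v) //.
  by rewrite (Fs a _ u Fu) // mem_head.
by move=> i si; apply: Fs; rewrite inE si orbT.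
Qed.

Lemma lprod_star (T : Type) k (F : nat -> language T) s w :
  (forall i, i \in s -> 1 <= i <= k) -> lprod F s w -> star (level_union k F) w.
Proof.
elim: s w => [|a s IH] w ks /=; first by move=> ->; apply: star_nil.
move=> [u Fu [v Fv <-]]; apply: star_cons.
  by exists a => //; apply: ks; rewrite mem_head.
by apply: IH => // i si; apply: ks; rewrite inE si orbT.
Qed.

Lemma mem_leq_sumn (s : seq nat) i : i \in s -> i <= sumn s.
Proof. by move=> si; rewrite (perm_sumn (perm_to_rem si)) leq_addr. Qed.

Lemma overlap_codeP (T : Type) n k (L R : nat -> language T) w :
    k <= n -> n <= 2 * k -> LR_family k L R -> overlap_code n k L R w ->
  size w = n /\
  exists x l r y, [/\ w = x ++ (l ++ r) ++ y, k < size (l ++ r),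
    star (level_union k L) x /\ star (level_union k R) y,
    level_union k L l & level_union k R r].
Proof.
move=> kn n2k /LR_family_size sizeLR.
move=> [s /andP[ks sn] [j /andP[sj jk] [alpha [alpha0 sum_alpha] [i _]]]].
move=> [_ [x Lx [_ [l Ll [r Rr <-]] <-]] [y Ry <-]].
(* Each part is at most [n - s], and [n - s <= n - k <= k] since [k < s] and [n <= 2 * k]; hence no
   level above [k] occurs. *)
have parts a : a \in alpha -> 1 <= a <= k.
  move=> a_in; rewrite (allP alpha0) //=; apply: leq_trans (mem_leq_sumn a_in) _.
  rewrite sum_alpha leq_subLR; apply: leq_trans n2k _.
  by rewrite mul2n -addnn leq_add2r ltnW.
(* From [s - k <= j <= k < s], both [j] and [s - j] lie between 1 and [k]. *)
have j_k : 1 <= j <= k by rewrite jk andbT (leq_trans _ sj) // subn_gt0.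
have sj_k : 1 <= s - j <= k.
  by rewrite subn_gt0 (leq_ltn_trans jk) // leq_subLR addnC -leq_subLR.
have size_l : size l = j by apply: sizeLR => //; left.
have size_r : size r = s - j by apply: sizeLR => //; right.
have size_lr : size (l ++ r) = s.
  by rewrite size_cat size_l size_r subnKC // (leq_trans jk) // ltnW.
have size_x : size x = sumn (take i alpha).
  apply: lprod_size Lx => a /mem_take/parts ak v Lv.
  by apply: sizeLR => //; left.
have size_y : size y = sumn (drop i alpha).
  apply: lprod_size Ry => a /mem_drop/parts ak v Rv.
  by apply: sizeLR => //; right.
split.
  rewrite size_cat size_cat size_lr size_x size_y addnAC -sumn_cat cat_take_drop.
  by rewrite sum_alpha subnK.
exists x, l, r, y; split; last by exists (s - j).
- by rewrite -catA.
- by rewrite size_lr.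
- split; first by apply: lprod_star Lx => a /mem_take/parts.
  by apply: lprod_star Ry => a /mem_drop/parts.
- by exists j.
Qed.

Theorem mainTheorem3 (Sigma : finType) (n k : nat)
    (L R : nat -> language Sigma)
    (Sigma_ge2 : 2 <= #|Sigma|)
    (n_ge2 : 2 <= n)
    (k_bounds : 1 <= k <= n - 1)
    (k_ge_half : n <= 2 * k)
    (LR : LR_family k L R) :
  overlap_free_code n k (overlap_code n k L R).
Proof.
have kn : k <= n by case/andP: k_bounds => _ /leq_trans; apply; apply: leq_subr.
have AB := LR_family_splitting LR.
split=> [w /(overlap_codeP kn k_ge_half LR)[] //|t /andP[t0 tk]].
(* The two alternatives of [has_overlap] differ by exchanging [u] and [v], so one orientation
   suffices. *)
have no_common u v w : overlap_code n k L R u -> overlap_code n k L R v ->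
    size w = t -> prefix w u -> ~ suffix w v.
  move=> Cu Cv size_w /prefixP[q Eu] /suffixP[p Ev].
  have [_ [x [l [r [y [Eu' lt_lr [Ax _] Al Br]]]]]] := overlap_codeP kn k_ge_half LR Cu.
  have [_ [x' [l' [r' [y' [Ev' lt_lr' [_ By] Al' Br']]]]]] :=
    overlap_codeP kn k_ge_half LR Cv.
  have Aw : star (level_union k L) w.
    apply: (star_code_prefix AB Ax Al Br (y := y) (q := q)); first by rewrite -Eu'.
    by rewrite size_w (leq_ltn_trans tk).
  have Bw : star (level_union k R) w.
    apply: (star_code_suffix AB By Al' Br' (x := x') (p := p)); first by rewrite -Ev'.
    by rewrite size_w (leq_ltn_trans tk).
  by move: t0; rewrite -size_w (star_disjoint AB Aw Bw).
by move=> u v Cu Cv [] [w [size_w pw sw]]; [apply: (no_common u v w) | apply: (no_common v u w)].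
Qed.
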